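(* Let $n,m\ge1$. (1) Every congruence preserving function $f:\mathbb{Z}/n\mathbb{Z}\to\mathbb{Z}/m\mathbb{Z}$ is rat-polynomial with degree less than $\mu(m)$. (2) The family of rat-polynomial functions $\mathcal{F}=\{\mathrm{lcm}(k)P_k \mid 0\le k<\min(n,\mu(m))\}$ generates (as a $\mathbb{Z}/m\mathbb{Z}$-module) the set of congruence preserving functions $\mathbb{Z}/n\mathbb{Z}\to\mathbb{Z}/m\mathbb{Z}$. (3) $\mathcal{F}$ is a basis of the $\mathbb{Z}/m\mathbb{Z}$-module of congruence preserving functions $\mathbb{Z}/n\mathbb{Z}\to\mathbb{Z}/m\mathbb{Z}$ if and only if $m$ has no prime divisor $p<\min(n,m)$ (in case $n\ge m$ this means that $m$ is prime).
   Context: Elements of $\mathbb{Z}/n\mathbb{Z}$ are represented by $\{0,\dots,n-1\}$. A function $f:\mathbb{Z}/n\mathbb{Z}\to\mathbb{Z}/m\mathbb{Z}$ is congruence preserving if for every positive divisor $d$ of $m$ and all $a,b\in\{0,\dots,n-1\}$, $a\equiv b\pmod d$ implies $f(a)\equiv f(b)\pmod d$. A function $f$ is rat-polynomial if there is $R\in\mathbb{Q}[X]$ with $R(a)\in\mathbb{Z}$ and $f(a)\equiv R(a)\pmod m$ for all $a\in\{0,\dots,n-1\}$; its degree is the least degree of such $R$. $P_k$ denotes the function $x\mapsto\binom{x}{k}\bmod m$ on $\{0,\dots,n-1\}$, where $\binom{x}{k}=\frac1{k!}\prod_{i=0}^{k-1}(x-i)$. For $k\ge1$, $\mathrm{lcm}(k)$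 is the least common multiple of $1,\dots,k$, $\mathrm{lcm}(0)=1$, viewed in $\mathbb{Z}/m\mathbb{Z}$. For $m=p_1^{\alpha_1}\cdots p_\ell^{\alpha_\ell}$ (prime factorization), $\mu(m)=\max_i p_i^{\alpha_i}$. Functions form a $\mathbb{Z}/m\mathbb{Z}$-module under pointwise operations.
   Formalization: The parenthetical in (3), that for n ≥ m the condition means m is prime, is proved for m ≥ 2 only, since it fails for m = 1 (1 has no prime divisor but is not prime); μ(1) is taken to be 1. *)

(* Defs.v *)
From HB Require Import structures.
From mathcomp Require Import all_boot all_order all_algebra.

Set Implicit Arguments.
Unset Strict Implicit.
Unset Printing Implicit Defensive.

Import GRing.Theory.

(* Z/mZ for every m >= 1, represented by {0, ..., m - 1}. Unlike 'Z_m, this is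
   the zero ring when m = 1. The value m = 0 is junk. *)
Definition Zmod (m : nat) : Type := 'I_m.-1.+1.

HB.instance Definition _ (m : nat) := Finite.on (Zmod m).
HB.instance Definition _ (m : nat) := GRing.Zmodule.on (Zmod m).
HB.instance Definition _ (m : nat) :=
  GRing.Zmodule_isComPzRing.Build (Zmod m)
    (@Zp_mulA _) (@Zp_mulC _) (@Zp_mul1z m.-1) (@Zp_mul_addl _).

Definition Zmod_val (m : nat) (x : Zmod m) : nat := nat_of_ord x.
Coercion Zmod_val : Zmod >-> nat.

Lemma Zmod_val_natr (m k : nat) :
  0 < m -> Zmod_val (k%:R%R : Zmod m) = k %% m.
Proof.
case: m => // m _; elim: k => [|k IHk]; first by rewrite mod0n.
rewrite -[k.+1]addn1 natrD /Zmod_val /= in IHk *.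
by rewrite IHk modnDml modnDmr.
Qed.

(* The functions Z/nZ -> Z/mZ, with the pointwise Z/mZ-module structure. *)
Notation Zfun n m := {ffun Zmod n -> (Zmod m)^o}.

Section Modules.
Local Open Scope ring_scope.

Definition generates (R : pzRingType) (V : lmodType R) (I : finType)
    (e : I -> V) (S : V -> Prop) : Prop :=
  forall v : V, S v <-> exists c : I -> R, v = \sum_(i : I) c i *: e i.

Definition linearly_independent (R : pzRingType) (V : lmodType R)
    (I : finType) (e : I -> V) : Prop :=
  forall c : I -> R, \sum_(i : I) c i *: e i = 0 -> forall i : I, c i = 0.

Definition is_basis (R : pzRingType) (V : lmodType R) (I : finType)
    (e : I -> V) (S : V -> Prop) : Prop :=
  generates e S /\ linearly_independent e.

End Modules.

Section CongruencePreserving.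
Variables n m : nat.

Definition congruence_preserving (f : Zfun n m) : Prop :=
  forall d : nat, 0 < d -> d %| m ->
  forall a b : Zmod n, a = b %[mod d] ->
    Zmod_val (f a) = Zmod_val (f b) %[mod d].

Definition represents (r : {poly rat}) (f : Zfun n m) : Prop :=
  forall a : Zmod n, exists z : int,
    (r.[(a : nat)%:R] = z%:~R)%R /\
    (Posz (Zmod_val (f a)) = z %[mod Posz m])%Z.

Definition rat_polynomial (f : Zfun n m) : Prop :=
  exists r : {poly rat}, represents r f.

(* The zero polynomial is given degree 0. *)
Definition rat_polynomial_degree (f : Zfun n m) (d : nat) : Prop :=
  (exists r : {poly rat}, represents r f /\ (size r).-1 = d) /\
  (forall r : {poly rat}, represents r f -> d <= (size r).-1).

Definition binomial_fun (k : nat) : Zfun n m :=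
  [ffun x : Zmod n => ('C(x, k))%:R%R].

Definition lcm_upto (k : nat) : nat := \big[lcmn/1]_(1 <= i < k.+1) i.

(* The outer maxn only matters for m = 1, where mu 1 = 1. *)
Definition mu : nat := maxn 1 (\max_(p <- primes m) p ^ logn p m).

Definition lcm_binomial (k : nat) : Zfun n m :=
  (((lcm_upto k)%:R : Zmod m) *: binomial_fun k)%R.

Definition lcm_binomial_family (k : 'I_(minn n mu)) : Zfun n m :=
  lcm_binomial k.

End CongruencePreserving.

(* Main.v *)
Require Import Defs.
From mathcomp Require Import all_boot all_order all_algebra.
From Stdlib Require Import Classical_Prop.

Import GRing.Theory.

(** Lift f to an integer-valued F on {0, ..., n - 1} and expand it by Newton's
    formula, F x = \sum_k c_k 'C(x, k) with c_k the k-th difference of F at 0.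
    If q | m and q <= k < n, then q | c_k: for k = q this holds termwise in
    \sum_i (-1)^(q - i) 'C(q, i) (F i - F 0), and higher differences are
    integer combinations of shifts of the q-th one. By distributivity of gcd
    over lcm, gcd(m, lcm(k)) | c_k, so c_k is a multiple of lcm(k) modulo m;
    and m | lcm(k) as soon as k >= mu(m). Conversely lcm(k) 'C(x, k) preserves
    congruences by Vandermonde's identity. The matrix of the 'C(x, k) is
    unitriangular, so the family is free iff each lcm(k) occurring in it is
    a unit modulo m. *)

(** Being represented by a polynomial of a given degree is not a decidable property, so the least
    degree is found by classical reasoning. *)
Lemma ex_least_nat (P : nat -> Prop) (k : nat) :
  P k -> exists d, P d /\ forall e, P e -> d <= e.
Proof.
elim/ltn_ind: k => k IHk Pk.
have [[e [Pe lt_ek]]|nolt] := classic (exists e, P e /\ e < k).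
  exact: IHk Pe.
exists k; split=> // e Pe; rewrite leqNgt; apply/negP => lt_ek.
by apply: nolt; exists e.
Qed.

(** * Finite differences and Newton's formula *)

Section FiniteDifferences.
Local Open Scope ring_scope.

Fixpoint diff (k : nat) (F : nat -> int) (x : nat) : int :=
  if k is k'.+1 then diff k' F x.+1 - diff k' F x else F x.

Lemma diffD j k F x : diff (j + k) F x = diff j (diff k F) x.
Proof. by elim: j x => //= j IHj x; rewrite !IHj. Qed.

(** Differences of positive order kill constants, so [F] may be replaced by [F - F x]. *)
Lemma diff_subC k F (c : int) x :
  diff k.+1 (fun y => F y - c) x = diff k.+1 F x.
Proof.
elim: k x => [|k IHk] x; first by rewrite /= opprB addrA addrNK.
by rewrite /= in IHk *; rewrite !IHk.
Qed.

(** Pascal's rule, by induction on [k]. The sign exponent [k + i] has the parity of [k - i] and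
    avoids truncated subtraction. *)
Lemma diffE k F x :
  diff k F x = \sum_(i < k.+1) (-1) ^+ (k + i) * F (x + i)%N *+ 'C(k, i).
Proof.
elim: k x => [|k IHk] x.
  by rewrite big_ord1 /= !addn0 expr0 mul1r mulr1n.
rewrite [LHS]/= !IHk [RHS]big_ord_recl /=.
have pascal (i : 'I_k.+1) :
    (-1) ^+ (k.+1 + bump 0 i) * F (x + bump 0 i)%N *+ 'C(k.+1, bump 0 i) =
    (-1) ^+ (k + i) * F (x.+1 + i)%N *+ 'C(k, i)
    + (-1) ^+ (k + i) * F (x + i.+1)%N *+ 'C(k, i.+1).
  rewrite /bump /= add1n binS mulrnDr addrC addSn addnS !exprS !mulN1r opprK.
  by rewrite addSnnS.
rewrite [X in _ = _ + X](eq_bigr _ (fun i _ => pascal i)).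
rewrite [X in _ = _ + X]big_split /= addrCA; congr (_ + _).
rewrite big_ord_recl /= opprD !bin0 !mulr1n !addn0 exprS mulN1r mulNr.
congr (_ + _); rewrite [RHS]big_ord_recr /= bin_small // mulr0n addr0.
rewrite -sumrN; apply: eq_bigr => i _.
by rewrite /bump /= add1n !addnS exprS mulN1r mulNr mulNrn opprK.
Qed.

(** The induction step moves the base point from [x] to [x.+1] and applies Pascal's rule. Any bound
    [N > j] will do, since the terms with [k > j] vanish. *)
Lemma newton_forward N j F x : (j < N)%N ->
  F (x + j)%N = \sum_(k < N) diff k F x *+ 'C(j, k).
Proof.
elim: j x N => [|j IHj] x [//|N] ltjN.
  rewrite big_ord_recl /= addn0 mulr1n big1 ?addr0 //.
rewrite addnS -addSn (IHj _ N.+1) 1?ltnW // [RHS]big_ord_recl bin0 /=.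
have pascal (i : 'I_N) : diff (bump 0 i) F x *+ 'C(j.+1, bump 0 i) =
    diff i.+1 F x *+ 'C(j, i.+1) + diff i.+1 F x *+ 'C(j, i).
  by rewrite /bump add1n binS mulrnDr.
rewrite [X in _ = _ + X](eq_bigr _ (fun i _ => pascal i)) big_split addrA.
have -> : F x *+ 1 + \sum_(i < N) (diff i F x.+1 - diff i F x) *+ 'C(j, i.+1)
    = \sum_(k < N.+1) diff k F x *+ 'C(j, k).
  by rewrite [RHS]big_ord_recl bin0.
rewrite big_ord_recr [X in _ = X + _]big_ord_recr /= !bin_small // !mulr0n !addr0.
rewrite -big_split /=; apply: eq_bigr => i _.
by rewrite -mulrnDl addrC subrK.
Qed.

Lemma dvdz_diff (q : int) k F x :
  (forall i, (i <= k)%N -> (q %| F (x + i)%N)%Z) -> (q %| diff k F x)%Z.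
Proof.
move=> qF; rewrite diffE; apply: rpred_sum => i _.
by rewrite rpredMn // dvdz_mull // qF // -ltnS.
Qed.

(** Both [q * 'C(q, i)] and [i * 'C(q, i) = q * 'C(q.-1, i.-1)] are multiples of [q], hence so is
    their gcd. *)
Lemma dvdn_bin_gcd q i : (q %| 'C(q, i) * gcdn q i)%N.
Proof.
rewrite muln_gcdr dvdn_gcd dvdn_mull //=.
by case: i => [|i]; rewrite ?muln0 ?dvdn0 // mulnC -mul_bin_diag dvdn_mulr.
Qed.

(* Termwise in the expansion of the q-th difference of F - F x:
   q divides 'C(q, i) * gcd(q, i), and gcd(q, i) divides F (x + i) - F x. *)
Lemma dvdz_diff_congr q F x : (0 < q)%N ->
  (forall i, (i <= q)%N -> (Posz (gcdn q i) %| F (x + i)%N - F x)%Z) ->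
  (Posz q %| diff q F x)%Z.
Proof.
case: q => // q _ qF; rewrite -(diff_subC _ _ (F x)) diffE.
apply: rpred_sum => i _; rewrite -mulrnAr dvdz_mull //.
have /dvdzP[z ->] := qF i (ltn_ord i).
rewrite -mulrnAr dvdz_mull // -mulr_natl natz -PoszM.
exact: dvdn_bin_gcd.
Qed.

(** The [k]-th difference is the [(k - q)]-th difference of the [q]-th one. Only arguments up to [k]
    enter, which matters because [F] will carry meaning only below [n]. *)
Lemma dvdz_diff_large q k F : (0 < q <= k)%N ->
  (forall x i, (x + i <= k)%N -> (Posz (gcdn q i) %| F (x + i)%N - F x)%Z) ->
  (Posz q %| diff k F 0)%Z.
Proof.
move=> /andP[q0 leqk] qF; rewrite -(subnK leqk) diffD.
apply: dvdz_diff => x lex; rewrite add0n; apply: dvdz_diff_congr => // i lei.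
by apply: qF; rewrite -(subnK leqk) leq_add.
Qed.

End FiniteDifferences.

(** * Divisibility properties of lcm(k) and mu(m) *)

Lemma lcm_uptoS k : lcm_upto k.+1 = lcmn (lcm_upto k) k.+1.
Proof. by rewrite /lcm_upto big_nat_recr. Qed.

Lemma dvdn_lcm_upto i k : 0 < i <= k -> i %| lcm_upto k.
Proof.
elim: k => [|k IHk]; first by case: i.
rewrite lcm_uptoS => /andP[i0]; rewrite leq_eqVlt => /orP[/eqP->|ltik].
  exact: dvdn_lcmr.
by apply: dvdn_trans (IHk _) (dvdn_lcml _ _); rewrite i0.
Qed.

(** By distributivity, gcd(m, lcm(k)) is the lcm of the gcd(m, i) for 1 <= i <= k. *)
Lemma gcdn_lcm_upto_dvd m k c :
  (forall i, 0 < i <= k -> gcdn m i %| c) -> gcdn m (lcm_upto k) %| c.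
Proof.
elim: k => [|k IHk] mc; first by rewrite /lcm_upto big_geq // gcdn1 dvd1n.
rewrite lcm_uptoS gcdnC Order.NatDvd.meetUl dvdn_lcm !(gcdnC _ m) (mc k.+1) ?leqnn //.
by rewrite andbT IHk // => i /andP[i0 ik]; rewrite mc // i0 leqW.
Qed.

(** A nontrivial gcd(m, i) with i <= k would have a prime factor that divides m and is at most k. *)
Lemma coprime_lcm_upto m k :
  (forall p, prime p -> p %| m -> k < p) -> coprime m (lcm_upto k).
Proof.
move=> mp; rewrite /coprime -dvdn1; apply: gcdn_lcm_upto_dvd => i /andP[i0 ik].
rewrite dvdn1; apply/negPn/negP => mi.
have pg : prime (pdiv (gcdn m i)).
  by rewrite pdiv_prime // ltn_neqAle eq_sym mi gcdn_gt0 i0 orbT.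
have /(leq_ltn_trans ik)/ltn_geF/negbT/negP[] :=
  mp _ pg (dvdn_trans (pdiv_dvd _) (dvdn_gcdl _ _)).
by rewrite dvdn_leq // (dvdn_trans (pdiv_dvd _) (dvdn_gcdr _ _)).
Qed.

Lemma prime_pow_leq_mu p m : 0 < m -> prime p -> p %| m -> p ^ logn p m <= mu m.
Proof.
move=> m0 pp pm; rewrite /mu leq_max; apply/orP; right.
by apply: (@leq_bigmax_seq _ _ xpredT (fun p => p ^ logn p m));
  rewrite // mem_primes pp m0 pm.
Qed.

Lemma mu_leq m : 0 < m -> mu m <= m.
Proof.
move=> m0; rewrite /mu geq_max m0; apply/bigmax_leqP_seq => p _ _.
by rewrite dvdn_leq // pfactor_dvdnn.
Qed.

(** Each prime power in the factorization of [m] is at most [mu m], so it is one of 1, ..., k. *)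
Lemma dvdn_lcm_upto_mu m k : 0 < m -> mu m <= k -> m %| lcm_upto k.
Proof.
move=> m0 muk; apply/dvdn_partP => // p.
rewrite mem_primes => /and3P[pp _ pm]; rewrite p_part; apply: dvdn_lcm_upto.
by rewrite expn_gt0 prime_gt0 // (leq_trans (prime_pow_leq_mu _ _ m0 pp pm)).
Qed.

(* Otherwise mu m is the least prime divisor q of m; every prime power in the
   factorization of m is then q itself, so that m = q. *)
Lemma pdiv_lt_mu m : 1 < m -> pdiv m < m -> pdiv m < mu m.
Proof.
move=> m1 ltm; have m0 := ltnW m1.
have leq_pow p : prime p -> p %| m -> p <= p ^ logn p m.
  by move=> pp pm; rewrite -{1}(expn1 p) leq_exp2l ?prime_gt1 // logn_gt0
    mem_primes pp m0.
have pq := pdiv_prime m1; have qm := pdiv_dvd m.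
have := leq_trans (leq_pow _ pq qm) (prime_pow_leq_mu _ _ m0 pq qm).
rewrite leq_eqVlt => /orP[/eqP eqmu|//].
suff /(dvdn_leq (pdiv_gt0 _)) : m %| pdiv m by rewrite leqNgt ltm.
apply/dvdn_partP => // p; rewrite mem_primes => /and3P[pp _ pm]; rewrite p_part.
have lepow := prime_pow_leq_mu _ _ m0 pp pm.
have leqp : pdiv m <= p by rewrite pdiv_min_dvd ?prime_gt1.
suff -> : p ^ logn p m = pdiv m by [].
by apply/eqP; rewrite eqn_leq {1}eqmu lepow (leq_trans leqp) ?leq_pow.
Qed.

(** * Congruence preservation by lcm(k) times a binomial *)

(** [i] divides lcm(k), and [i * 'C(h, i) = h * 'C(h.-1, i.-1)]. *)
Lemma dvdn_lcm_upto_mul_bin k i h :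
  0 < i <= k -> h %| lcm_upto k * 'C(h, i).
Proof.
move=> ik; have /dvdnP[u ->] := dvdn_lcm_upto _ _ ik.
case: i ik => // i _; rewrite -mulnA -mul_bin_diag mulnCA.
exact: dvdn_mulr.
Qed.

Lemma lcm_upto_bin_congr k d a b :
  a = b %[mod d] -> lcm_upto k * 'C(a, k) = lcm_upto k * 'C(b, k) %[mod d].
Proof.
wlog leab : a b / a <= b => [IH|] eqab.
  by case/orP: (leq_total a b) => le; [|symmetry]; apply: IH.
have /dvdnP[t def_t] : d %| b - a by rewrite -eqn_mod_dvd // eqab.
have -> : b = (b - a) + a by rewrite subnK.
set h := b - a in def_t *.
(* With [b = h + a], the term of index 0 is ['C(a, k)]; all others become multiples of [h], hence of
   [d], once multiplied by lcm(k). *)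
rewrite -(binomial.Vandermonde h a k) big_ord_recl /= bin0 mul1n subn0 mulnDr.
rewrite big_distrr /= -modnDmr.
suff /eqP -> : d %| \sum_(i < k) lcm_upto k
   * ('C(h, bump 0 i) * 'C(a, k - bump 0 i)) by rewrite addn0.
apply: dvdn_sum => i _; rewrite mulnA dvdn_mulr //.
apply: (@dvdn_trans h); first by rewrite def_t dvdn_mull.
by apply: dvdn_lcm_upto_mul_bin; rewrite /bump /= add1n ltn_ord.
Qed.

(** * Binomial coefficients as rational polynomials *)

Section BinomialPolynomials.
Local Open Scope ring_scope.

Definition bin_poly (k : nat) : {poly rat} :=
  (k`!%:R)^-1 *: \prod_(i < k) ('X - (i%:R)%:P).

Lemma size_bin_poly k : (size (bin_poly k) <= k.+1)%N.
Proof.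
apply: leq_trans (size_scale_leq _ _) _.
by rewrite size_prod_XsubC /index_enum -enumT size_enum_ord.
Qed.

Lemma horner_bin_poly k (x : nat) : (bin_poly k).[x%:R] = 'C(x, k)%:R.
Proof.
have fk : k`!%:R != 0 :> rat by rewrite Num.Theory.pnatr_eq0 -lt0n fact_gt0.
apply: (mulfI fk); rewrite hornerZ mulrA mulfV // mul1r -natrM mulnC bin_ffact.
elim: k {fk} => [|k IHk]; first by rewrite big_ord0 hornerE.
rewrite big_ord_recr /= hornerM IHk hornerXsubC ffactnSr natrM.
have [lekx|ltxk] := leqP k x; first by rewrite natrB.
by rewrite ffact_small // !mul0r.
Qed.

End BinomialPolynomials.

(** * Combinations of the family as functions into Z/mZ *)

Section ZmodFunctions.
Variables n m : nat.
Hypothesis m_gt0 : 0 < m.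
Local Open Scope ring_scope.

Lemma natr_Zmod_val (x : Zmod m) : (Zmod_val x)%:R = x.
Proof.
apply: val_inj; rewrite -[LHS]/(Zmod_val _) Zmod_val_natr // modn_small //.
by case: m m_gt0 x => // m' _ x; apply: ltn_ord.
Qed.

Lemma natr_Zmod_eq0 k : (k%:R == 0 :> Zmod m) = (m %| k)%N.
Proof.
apply/eqP/idP => [k0|mk].
  by rewrite /dvdn -(Zmod_val_natr k m_gt0) k0.
by apply: val_inj; rewrite -[LHS]/(Zmod_val _) Zmod_val_natr // (eqP mk).
Qed.

Lemma intr_Zmod_eq0 (z : int) : (Posz m %| z)%Z -> z%:~R = 0 :> Zmod m.
Proof.
move=> /dvdzP[u ->]; rewrite intrM.
by rewrite [m%:~R](_ : _ = m%:R) // (eqP (_ : m%:R == 0)) ?mulr0 ?natr_Zmod_eq0.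
Qed.

(** Bezout: gcd(m, L) is a multiple of [L] modulo [m]. *)
Lemma intr_Zmod_mulP (L : nat) (z : int) :
  (Posz (gcdn m L) %| z)%Z -> exists u : Zmod m, z%:~R = u * L%:R.
Proof.
have [s [t eqg]] := Bezoutz (Posz m) (Posz L).
move=> /dvdzP[w ->]; rewrite -[Posz (gcdn m L)]/(gcdz (Posz m) (Posz L)) -eqg.
exists (w * t)%:~R; rewrite mulrDr intrD intr_Zmod_eq0.
  by rewrite add0r mulrA intrM.
by rewrite mulrA dvdz_mull.
Qed.

Lemma lcm_binomial_sumE N (c : 'I_N -> Zmod m) (a : Zmod n) :
  (\sum_(k < N) c k *: lcm_binomial n m k) a =
    \sum_(k < N) c k * (lcm_upto k)%:R * 'C(a, k)%:R.
Proof.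
rewrite sum_ffunE; apply: eq_bigr => k _.
by rewrite /lcm_binomial scalerA !ffunE.
Qed.

(** Lifting the coefficients to naturals makes the value the residue of one natural number, which
    can be reduced modulo any divisor of [m] or compared with a rational polynomial. *)
Lemma lcm_binomial_sum_natr N (c : 'I_N -> Zmod m) (a : Zmod n) :
  (\sum_(k < N) c k *: lcm_binomial n m k) a =
    (\sum_(k < N) Zmod_val (c k) * (lcm_upto k * 'C(a, k)))%N%:R.
Proof.
rewrite lcm_binomial_sumE natr_sum; apply: eq_bigr => k _.
by rewrite !natrM natr_Zmod_val mulrA.
Qed.

Lemma lcm_binomial_sum_congruence_preserving N (c : 'I_N -> Zmod m) :
  congruence_preserving (\sum_(k < N) c k *: lcm_binomial n m k).
Proof.
move=> d d0 dm a b eqab; rewrite !lcm_binomial_sum_natr !Zmod_val_natr //.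
rewrite !modn_dvdm //.
apply: (big_ind2 (fun x y => x = y %[mod d])%N) => [//|x1 x2 y1 y2 ex ey|k _].
  by rewrite -modnDm ex ey modnDm.
by rewrite -modnMmr (lcm_upto_bin_congr _ _ _ _ eqab) modnMmr.
Qed.

Lemma lcm_binomial_sum_represented N (c : 'I_N -> Zmod m) :
  exists r : {poly rat},
    represents r (\sum_(k < N) c k *: lcm_binomial n m k) /\ (size r <= N)%N.
Proof.
exists (\sum_(k < N) (Zmod_val (c k) * lcm_upto k)%N%:R *: bin_poly k).
split; last first.
  apply: leq_trans (size_sum _ _ _) _; apply/bigmax_leqP => k _.
  apply: leq_trans (size_scale_leq _ _) _.
  exact: leq_trans (size_bin_poly k) (ltn_ord k).
move=> a.
exists (Posz (\sum_(k < N) Zmod_val (c k) * (lcm_upto k * 'C(a, k)))); split.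
  rewrite horner_sum -pmulrn natr_sum; apply: eq_bigr => k _.
  by rewrite hornerZ horner_bin_poly -natrM mulnA.
by rewrite lcm_binomial_sum_natr Zmod_val_natr // !modz_nat modn_mod.
Qed.

Lemma lcm_binomial_rat_polynomial k : rat_polynomial (lcm_binomial n m k).
Proof.
have [r [rP _]] := lcm_binomial_sum_represented k.+1
  (fun i => (nat_of_ord i == k)%:R).
exists r; move: rP; rewrite big_ord_recr /= eqxx scale1r big1 ?add0r // => i _.
by rewrite ltn_eqF ?scale0r.
Qed.

Lemma lcm_upto_Zmod_eq0 k : (mu m <= k)%N -> (lcm_upto k)%:R = 0 :> Zmod m.
Proof. by move=> muk; apply/eqP; rewrite natr_Zmod_eq0 dvdn_lcm_upto_mu. Qed.

(** * Generation through the Newton expansion *)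

Hypothesis n_gt0 : (0 < n)%N.

Lemma Zmod_val_lt (a : Zmod n) : (Zmod_val a < n)%N.
Proof. by rewrite -[X in (_ < X)%N](prednK n_gt0) ltn_ord. Qed.

Lemma Zmod_val_inord k : (k < n)%N -> Zmod_val (inord k : Zmod n) = k.
Proof. by move=> kn; rewrite /Zmod_val inordK // prednK. Qed.

Lemma congruence_preserving_gcd_dvd (f : Zfun n m) k :
  congruence_preserving f -> (k < n)%N ->
  (Posz (gcdn m (lcm_upto k)) %|
     diff k (fun x => Posz (Zmod_val (f (inord x)))) 0)%Z.
Proof.
move=> fcp kn; apply: gcdn_lcm_upto_dvd => i /andP[i0 ik].
(* The moduli that occur are gcd(gcd(m, i), j). They divide [m], so [f] preserves them, and [j], so
   [x + j] and [x] agree. As [x + j <= k < n], [inord] never takes its default value. *)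
apply: (dvdz_diff_large (gcdn m i)) => [|x j xjk].
  by rewrite gcdn_gt0 m_gt0 (leq_trans _ ik) // dvdn_leq // dvdn_gcdr.
set q := gcdn m i; rewrite -eqz_mod_dvd !modz_nat eqz_nat; apply/eqP.
have xjn := leq_ltn_trans xjk kn.
apply: fcp; first by rewrite !gcdn_gt0 m_gt0.
  by rewrite (dvdn_trans (dvdn_gcdl _ _)) // dvdn_gcdl.
rewrite !Zmod_val_inord ?(leq_ltn_trans (leq_addr j x)) //.
apply/eqP; rewrite -[X in _ == X %[mod _]]addn0 eqn_modDl mod0n.
exact: dvdn_gcdr.
Qed.

Lemma congruence_preserving_lcm_sum (f : Zfun n m) :
  congruence_preserving f ->
  exists c : 'I_(minn n (mu m)) -> Zmod m,
    f = \sum_(k < minn n (mu m)) c k *: lcm_binomial n m k.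
Proof.
move=> fcp; set F := fun x => Posz (Zmod_val (f (inord x))).
have /fin_all_exists[c cE] (k : 'I_n) :
    exists u : Zmod m, (diff k F 0)%:~R = u * (lcm_upto k)%:R.
  by apply: intr_Zmod_mulP; apply: congruence_preserving_gcd_dvd.
exists (fun k => c (widen_ord (geq_minl _ _) k)); apply/ffunP => a.
rewrite (lcm_binomial_sumE _ (fun k => c (widen_ord (geq_minl _ _) k))).
transitivity ((F (Zmod_val a))%:~R : Zmod m).
  by rewrite /F -pmulrn natr_Zmod_val /Zmod_val inord_val.
rewrite -[F _]/(F (0 + Zmod_val a)%N) (newton_forward n) ?Zmod_val_lt //.
rewrite rmorph_sum /=.
transitivity (\sum_(k < n) c k * (lcm_upto k)%:R * 'C(a, k)%:R).
  by apply: eq_bigr => k _; rewrite rmorphMn /= cE [RHS]mulr_natr.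
(* Newton's formula runs over all [k < n]; the terms with [k >= mu m] vanish because lcm(k) is 0 in
   Z/mZ. *)
rewrite (bigID (fun k : 'I_n => (k < minn n (mu m))%N)) /= [X in _ + X]big1 ?addr0.
  by rewrite (big_ord_narrow (geq_minl n (mu m))).
move=> k; rewrite leq_min ltn_ord /= -leqNgt => muk.
by rewrite lcm_upto_Zmod_eq0 // mulr0 mul0r.
Qed.

Lemma lcm_binomial_generates :
  generates (@lcm_binomial_family n m) (@congruence_preserving n m).
Proof.
move=> f; split=> [/congruence_preserving_lcm_sum[c ->]|[c ->]].
  by exists c.
exact: lcm_binomial_sum_congruence_preserving.
Qed.

Lemma congruence_preserving_degree (f : Zfun n m) :
  congruence_preserving f ->
  rat_polynomial f /\ exists d, rat_polynomial_degree f d /\ (d < mu m)%N.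
Proof.
move=> /congruence_preserving_lcm_sum[c ->].
have [r [rP sr]] := lcm_binomial_sum_represented _ c.
split; first by exists r.
pose P d := exists r : {poly rat},
  represents r (\sum_(k < minn n (mu m)) c k *: lcm_binomial n m k)
  /\ (size r).-1 = d.
have Pr : P (size r).-1 by exists r.
have [d [Pd dmin]] := ex_least_nat P _ Pr; exists d; split.
  by split=> // r' r'P; apply: dmin; exists r'.
apply: leq_ltn_trans (dmin _ Pr) _.
(* Covers the zero polynomial, whose degree is 0 by convention. *)
have mu0 : (0 < mu m)%N by rewrite leq_max.
by case: (size r) sr => [//|s] /=; rewrite leq_min => /andP[].
Qed.

(** * Linear independence *)

(** Evaluate at [k]: the terms below [k] vanish by induction, those above because ['C(k, j) = 0] for
    [j > k]. *)
Lemma lcm_binomial_sum_eq0 N (c : 'I_N -> Zmod m) : (N <= n)%N ->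
  \sum_(k < N) c k *: lcm_binomial n m k = 0 ->
  forall k, c k * (lcm_upto k)%:R = 0.
Proof.
move=> leNn sum0 [k kN]; elim/ltn_ind: k kN => k IHk kN.
have kn := leq_trans kN leNn.
have := lcm_binomial_sumE _ c (inord k : Zmod n).
rewrite sum0 ffunE Zmod_val_inord // (bigD1 (Ordinal kN)) //= binn mulr1.
rewrite big1 ?addr0 // => -[j jN] /=; rewrite -val_eqE /= neq_ltn.
case/orP=> [ltjk|ltkj]; first by rewrite IHk // mul0r.
by rewrite bin_small // mulr0.
Qed.

Lemma lcm_binomial_independent :
  ~ (exists p, [/\ prime p, (p %| m)%N & (p < minn n m)%N]) ->
  linearly_independent (@lcm_binomial_family n m).
Proof.
move=> nop c sum0 k.
have/eqP := lcm_binomial_sum_eq0 _ _ (geq_minl _ _) sum0 k.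
rewrite -(natr_Zmod_val (c k)) -natrM natr_Zmod_eq0 Gauss_dvdl.
  by rewrite -natr_Zmod_eq0 => /eqP.
(* A prime divisor [p <= k] of [m] would lie below min(n, m), since [k < minn n (mu m)] and
   [mu m <= m]. *)
apply: coprime_lcm_upto => p pp pm; rewrite ltnNge; apply/negP => pk.
apply: nop; exists p; split=> //; apply: leq_ltn_trans pk _.
apply: leq_trans (ltn_ord k) _.
by rewrite leq_min geq_minl (leq_trans (geq_minr _ _)) ?mu_leq.
Qed.

Lemma lcm_binomial_dependent p :
  prime p -> (p %| m)%N -> (p < minn n m)%N ->
  ~ linearly_independent (@lcm_binomial_family n m).
Proof.
move=> pp pm; rewrite leq_min => /andP[pn ltpm] indep.
have m1 : (1 < m)%N := ltn_trans (prime_gt1 pp) ltpm.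
have leqp : (pdiv m <= p)%N by rewrite pdiv_min_dvd ?prime_gt1.
have qmin : (pdiv m < minn n (mu m))%N.
  by rewrite leq_min (leq_ltn_trans leqp pn) pdiv_lt_mu // (leq_ltn_trans leqp).
(* With q the least prime divisor of [m], the scalar m/q is nonzero but kills lcm(q), which is a
   multiple of q. This gives a nontrivial relation on the member of index q. *)
pose k0 := Ordinal qmin; pose w : Zmod m := (m %/ pdiv m)%:R.
have /(_ _ k0)/eqP := indep (fun k => if k == k0 then w else 0).
rewrite eqxx natr_Zmod_eq0 => mq.
have mq0 : (0 < m %/ pdiv m)%N by rewrite divn_gt0 ?pdiv_gt0 // dvdn_leq ?pdiv_dvd.
suff /mq/(dvdn_leq mq0) : \sum_(k : 'I_(minn n (mu m)))
    (if k == k0 then w else 0) *: lcm_binomial_family k = 0.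
  by rewrite leqNgt ltn_Pdiv ?prime_gt1 ?pdiv_prime.
rewrite (bigD1 k0) //= eqxx big1 => [|k /negbTE->]; last by rewrite scale0r.
rewrite addr0 /lcm_binomial_family /lcm_binomial scalerA /w -natrM.
rewrite (eqP (_ : _%:R == 0)) ?scale0r // natr_Zmod_eq0.
rewrite -[X in (X %| _)%N](divnK (pdiv_dvd m)) dvdn_mul // dvdn_lcm_upto //.
by rewrite pdiv_gt0 leqnn.
Qed.

End ZmodFunctions.

(** * Primality criterion for n >= m, and the three claims *)

Lemma no_small_prime_divisorP m : 1 < m ->
  ~ (exists p, [/\ prime p, p %| m & p < m]) <-> prime m.
Proof.
move=> m1; split=> [nop|pm [p [pp]]].
  have := dvdn_leq (ltnW m1) (pdiv_dvd m).
  rewrite leq_eqVlt => /orP[/eqP<-|ltm]; first exact: pdiv_prime.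
  by case: nop; exists (pdiv m); rewrite pdiv_prime ?pdiv_dvd.
by rewrite dvdn_prime2 // => /eqP->; rewrite ltnn.
Qed.

Theorem theorem3p13 (n m : nat) (hn : 0 < n) (hm : 0 < m) :
  (* (1) *)
  (forall f : Zfun n m, congruence_preserving f ->
     rat_polynomial f /\
     exists d : nat, rat_polynomial_degree f d /\ d < mu m) /\
  (* (2) *)
  ((forall k : 'I_(minn n (mu m)),
      rat_polynomial (@lcm_binomial_family n m k)) /\
   generates (@lcm_binomial_family n m) (@congruence_preserving n m)) /\
  (* (3) *)
  (is_basis (@lcm_binomial_family n m) (@congruence_preserving n m) <->
     ~ (exists p : nat, [/\ prime p, p %| m & p < minn n m])) /\
  (1 < m -> m <= n ->
     (~ (exists p : nat, [/\ prime p, p %| m & p < minn n m])) <-> prime m).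
Proof.
split; first by move=> f; apply: congruence_preserving_degree.
split.
  split; last exact: lcm_binomial_generates.
  by move=> k; apply: lcm_binomial_rat_polynomial.
split; last by move=> m1 lemn; rewrite (minn_idPr lemn) no_small_prime_divisorP.
split=> [[_ indep] [p [pp pm pmin]]|nop].
  exact: lcm_binomial_dependent pp pm pmin indep.
split; first exact: lcm_binomial_generates.
exact: lcm_binomial_independent.
Qed.
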